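(* Let $P_1,P_2$ be $\mu$-invariant Markov kernels on $(E,\mathscr{E})$ such that for a sieve $\Phi$ (non-expansive for both $P_1$ and $P_2$, and such that some $f\in L^2_0(\mu)$ has $0<\Phi(f)<\infty$): (1) $P_1^*P_1$ satisfies a $(\Phi,\alpha_1,\beta_1)$-WPI and $P_2^*P_2$ satisfies a $(\Phi,\alpha_2,\beta_2)$-WPI; (2) $\mathcal{E}(P_1^*P_1,g)\ge\mathcal{E}(P_2^*P_2,g)$ for any $g\in L^2(\mu)$ such that $\Phi(g)\le1$. Then, with $\alpha_i^\star(\cdot;\Phi)$ and $\beta_i^\star(\cdot;\Phi)$ the optimal functions for $P_i^*P_i$, $i=1,2$, a $(\Phi,\alpha_i^\star,\beta_i^\star)$-WPI holds for $P_i^*P_i$, $i=1,2$, and the corresponding convergence rates satisfy $\gamma_1^\star\le\gamma_2^\star$ pointwise.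
   Context: $(E,\mathscr{E})$ is a measurable space, $\mu$ a probability measure on it. $L^2_0(\mu)$ is the set of real $f\in L^2(\mu)$ with $\mu(f)=0$; $\mathcal{E}(T,f)=\langle(\mathrm{Id}-T)f,f\rangle$ in $L^2(\mu)$; $P^*$ is the adjoint. ''Decreasing'' means non-increasing. Sieve: $\Phi:L^2(\mu)\to[0,\infty]$ with $\Phi(cf)=c^2\Phi(f)$ for $c>0$ and $\|f-\mu(f)\|_2^2\le\mathfrak{a}\,\Phi(f-\mu(f))$ for all $f\in L^2(\mu)$, where $\mathfrak{a}:=\sup_{f\in L^2_0(\mu)\setminus\{0\}}\|f\|_2^2/\Phi(f)<\infty$. It is $P$-non-expansive if $\Phi(Pf)\le\Phi(f)$ for $f\in L^2_0(\mu)$. $(\Phi,\alpha)$-WPI for $T$: $\alpha:(0,\infty)\to[0,\infty)$ is decreasing and $\|f\|_2^2\le\alpha(r)\mathcal{E}(T,f)+r\Phi(f)$ for all $r>0$, $f\in L^2_0(\mu)$. $(\Phi,\beta)$-WPI for $T$: $\beta:(0,\infty)\to[0,\infty)$ is decreasing, $\beta(s)\to0$ as $s\to\infty$, and $\|f\|_2^2\le s\,\mathcal{E}(T,f)+\beta(s)\Phi(f)$ for all $s>0$, $f\in L^2_0(\mu)$. For decreasing $F:(0,\infty)\to\mathbb{R}$, $F^-(x)=\inf\{y>0:F(y)\le x\}$. A $(\Phi,\alpha,\beta)$-WPI means: a $(\Phi,\alpha)$-WPI with $\alpha$ right-continuous, $\alpha(r)=0$ for $r\ge\mathfrak{a}$,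 and $\beta=\alpha^-$ on $(0,\infty)$; or a $(\Phi,\beta)$-WPI with $\beta$ right-continuous, $\beta\le\mathfrak{a}$, and $\alpha=\beta^-$ on $(0,\infty)$ (in either case both WPIs hold, $\beta=\alpha^-$ and $\alpha=\beta^-$). Optimal functions for $T=P_i^*P_i$: $\alpha_i^\star(r;\Phi)=\sup\{(\|g\|_2^2-r)/\mathcal{E}(T,g):g\in L^2_0(\mu),\Phi(g)=1\}\vee0$ for $r>0$, and $\beta_i^\star(s;\Phi)=\sup\{\|g\|_2^2-s\,\mathcal{E}(T,g):g\in L^2_0(\mu),\Phi(g)=1\}\vee0$ for $s>0$. Convergence rate attached to $\beta$: $K(u)=u\beta(1/u)$ for $u>0$, $K(0)=0$; $K^*(v)=\sup_{u\ge0}\{uv-K(u)\}$; $F_{\mathfrak a}(x)=\int_x^{\mathfrak a}\mathrm{d}v/K^*(v)$ for $x\in(0,\mathfrak{a}]$; $\gamma(n)=F_{\mathfrak a}^{-1}(n)$. $\gamma_i^\star$ is the rate attached to $\beta_i^\star(\cdot;\Phi)$. *)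

(* Defs.v *)
From mathcomp Require Import all_boot all_order all_algebra.
From mathcomp Require Import all_classical all_reals all_analysis.
Import Order.TTheory GRing.Theory Num.Theory numFieldNormedType.Exports.

Set Implicit Arguments.
Unset Strict Implicit.
Unset Printing Implicit Defensive.

Local Open Scope classical_set_scope.
Local Open Scope ring_scope.

(** Elements of L^2(mu) are represented by square-integrable functions;
    whatever is defined on L^2(mu) is required to respect mu-a.e. equality. *)

Section L2.
Context {d : measure_display} {E : measurableType d} {R : realType}.
Variable mu : probability E R.

Definition L2 : set (E -> R) := [set f | f \in Lfun mu 2%:E].

Definition mean (f : E -> R) : R := \int[mu]_x f x.

Definition L20 : set (E -> R) := [set f | L2 f /\ mean f = 0].

Definition inner (f g : E -> R) : R := \int[mu]_x (f x * g x).

Definition sqnorm (f : E -> R) : R := fine 'N[mu]_(2%:E)[EFin \o f]%E ^+ 2.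

Definition invariant_kernel (P : R.-pker E ~> E) : Prop :=
  forall A : set E, measurable A -> (\int[mu]_x P x A = mu A)%E.

Definition kernel_op (P : R.-pker E ~> E) (f : E -> R) : E -> R :=
  fun x => \int[P x]_y f y.

(** [adjoint S g] is, up to a mu-null set, the unique h in L^2(mu) such that
    <S f, g> = <f, h> for all f in L^2(mu); for S bounded on L^2(mu) such an h
    exists by the Riesz representation theorem. *)
Definition adjoint (S : (E -> R) -> E -> R) (g : E -> R) : E -> R :=
  get [set h | L2 h /\ forall f, L2 f -> inner (S f) g = inner f h].

Definition dirichlet (T : (E -> R) -> E -> R) (f : E -> R) : R :=
  inner (fun x => f x - T f x) f.

Definition PstarP (P : R.-pker E ~> E) : (E -> R) -> E -> R :=
  fun f => adjoint (kernel_op P) (kernel_op P f).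

(** In \bar R, x / 0 = +oo for x > 0 and x / +oo = 0. *)
Definition sieve_cst (Phi : (E -> R) -> \bar R) : \bar R :=
  ereal_sup [set ((sqnorm f)%:E / Phi f)%E | f in
    [set f | L20 f /\ ~ (f = cst 0 %[ae mu])]].

Record sieve (Phi : (E -> R) -> \bar R) : Prop := Sieve {
  sieve_ge0 : forall f, L2 f -> (0 <= Phi f)%E ;
  sieve_ae : forall f g, L2 f -> L2 g -> f = g %[ae mu] -> Phi f = Phi g ;
  sieve_homog : forall (c : R) f, 0 < c -> L2 f ->
    Phi (fun x => c * f x) = ((c ^+ 2)%:E * Phi f)%E ;
  sieve_cst_fin : (sieve_cst Phi < +oo)%E ;
  sieve_le : forall f, L2 f ->
    ((sqnorm (fun x => f x - mean f))%:E
       <= sieve_cst Phi * Phi (fun x => f x - mean f)%R)%E }.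

Definition nonexpansive (Phi : (E -> R) -> \bar R) (P : R.-pker E ~> E) : Prop :=
  forall f, L20 f -> (Phi (kernel_op P f) <= Phi f)%E.

End L2.

(** A function (0, oo) -> \bar R is encoded as a function on R of which only the
    values at positive arguments matter. *)

Section Functions.
Context {R : realType}.

Definition pos_finite_valued (F : R -> \bar R) : Prop :=
  forall x : R, 0 < x -> (0 <= F x < +oo)%E.

Definition pos_decreasing (F : R -> \bar R) : Prop :=
  forall x y : R, 0 < x -> x <= y -> (F y <= F x)%E.

Definition pos_right_continuous (F : R -> \bar R) : Prop :=
  forall x : R, 0 < x -> F y @[y --> x^'+] --> F x.

(** F^- *)
Definition geninv (F : R -> \bar R) (x : R) : \bar R :=
  ereal_inf [set y%:E | y in [set y : R | 0 < y /\ (F y <= x%:E)%E]].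

End Functions.

Section WPI.
Context {d : measure_display} {E : measurableType d} {R : realType}.
Variables (mu : probability E R) (Phi : (E -> R) -> \bar R).
Variable T : (E -> R) -> E -> R.

Definition WPI_alpha (alpha : R -> \bar R) : Prop :=
  [/\ pos_finite_valued alpha, pos_decreasing alpha &
      forall (r : R) (f : E -> R), 0 < r -> L20 mu f ->
        ((sqnorm mu f)%:E
           <= alpha r * (dirichlet mu T f)%:E + r%:E * Phi f)%E].

(** The inequality is void when Phi f = +oo, also if beta s = 0; the guard is
    needed because 0 * +oo = 0 in \bar R. *)
Definition WPI_beta (beta : R -> \bar R) : Prop :=
  [/\ pos_finite_valued beta, pos_decreasing beta,
      beta s @[s --> +oo%R] --> 0%E &
      forall (s : R) (f : E -> R), 0 < s -> L20 mu f -> (Phi f < +oo)%E ->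
        ((sqnorm mu f)%:E
           <= (s * dirichlet mu T f)%:E + beta s * Phi f)%E].

Definition WPI (alpha beta : R -> \bar R) : Prop :=
  [/\ WPI_alpha alpha, pos_right_continuous alpha,
      (forall r : R, 0 < r -> (sieve_cst mu Phi <= r%:E)%E -> alpha r = 0%E) &
      (forall s : R, 0 < s -> beta s = geninv alpha s)]
  \/
  [/\ WPI_beta beta, pos_right_continuous beta,
      (forall s : R, 0 < s -> (beta s <= sieve_cst mu Phi)%E) &
      (forall r : R, 0 < r -> alpha r = geninv beta r)].

Definition alpha_star (r : R) : \bar R :=
  maxe (ereal_sup [set ((sqnorm mu g - r)%:E / (dirichlet mu T g)%:E)%E | g in
          [set g | L20 mu g /\ Phi g = 1%E]]) 0%E.

Definition beta_star (s : R) : \bar R :=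
  maxe (ereal_sup [set (sqnorm mu g - s * dirichlet mu T g)%:E | g in
          [set g | L20 mu g /\ Phi g = 1%E]]) 0%E.

End WPI.

Section Rate.
Context {R : realType}.
Variables (a : R) (beta : R -> \bar R).

Definition Kfun (u : R) : \bar R :=
  if u == 0 then 0%E else (u%:E * beta u^-1)%E.

(** K^*(v), possibly +oo *)
Definition Kstar (v : R) : \bar R :=
  ereal_sup [set ((u * v)%:E - Kfun u)%E | u in [set u : R | 0 <= u]].

Definition Ffun (x : R) : \bar R :=
  (\int[lebesgue_measure]_(v in `[x, a]) (Kstar v)^-1)%E.

(** The inverse of Ffun : (0, a] -> [0, +oo), evaluated at n. *)
Definition rate (n : nat) : R :=
  'pinv_(fun=> 0) [set x : R | 0 < x <= a] Ffun n%:R%:E.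

End Rate.

Definition rate_star {d : measure_display} {E : measurableType d} {R : realType}
    (mu : probability E R) (Phi : (E -> R) -> \bar R)
    (T : (E -> R) -> E -> R) : nat -> R :=
  rate (fine (sieve_cst mu Phi)) (beta_star mu Phi T).

(* Main.v *)
Require Import Defs.
From HB Require Import structures.
From mathcomp Require Import all_boot all_order all_algebra.
From mathcomp Require Import all_classical all_reals all_analysis.
From mathcomp Require Import measurable_realfun lra.
Import Order.TTheory GRing.Theory Num.Theory numFieldNormedType.Exports.
Set Implicit Arguments.
Unset Strict Implicit.
Unset Printing Implicit Defensive.
Local Open Scope classical_set_scope.
Local Open Scope ring_scope.

(** On the set of [g] in [L20 mu] with [Phi g = 1], both [alpha_star r <= s] and
    [beta_star s <= r] say that [sqnorm g <= s * dirichlet g + r] for all such [g];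
    hence [beta_star] is the generalized inverse of [alpha_star], and homogeneity
    of [sqnorm], [dirichlet] and [Phi] turns this into the WPI for every [f].
    The hypothesis that some WPI holds yields, for each [r > 0], one [s] for which
    the inequality holds, so [alpha_star] is finite, [beta_star] tends to 0 and
    [dirichlet g > 0].

    For the rates, [beta_star] is smaller for P1 than for P2, so [1 / Kstar], and
    with it [Ffun], is smaller as well.  As [Kstar] is bounded above on [0, v] for
    each [v < a], [Ffun] is strictly decreasing; as [Kstar] is bounded away from 0
    on [x, a] for each [x > 0], it is continuous.  These two facts compare the
    inverses. *)

(* Also true when [f] is not integrable: [c] positive preserves [oo], [-oo] and
   [oo - oo].  This makes [kernel_opZ] a pointwise identity. *)
Lemma gt0_RintegralZl d (T : measurableType d) (R : realType)
    (mu : {measure set T -> \bar R}) (f : T -> R) (c : R) :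
  0 < c -> measurable_fun setT f ->
  \int[mu]_x (c * f x) = c * \int[mu]_x f x.
Proof.
move=> c0 mf; rewrite /Rintegral integralE [in RHS]integralE.
have mf' : measurable_fun setT (EFin \o f) by exact/measurable_EFinP.
have -> : ((fun x => (c * f x)%:E)^\+)%E = (fun x => c%:E * (EFin \o f)^\+ x)%E.
  exact: (ge0_funeposM (EFin \o f) (ltW c0)).
have -> : ((fun x => (c * f x)%:E)^\-)%E = (fun x => c%:E * (EFin \o f)^\- x)%E.
  exact: (ge0_funenegM (EFin \o f) (ltW c0)).
rewrite !ge0_integralZl_EFin//; [|exact: measurable_funeneg|exact: ltW
  |exact: measurable_funepos|exact: ltW].
have := @integral_ge0 _ _ _ mu setT _ (fun x _ => funepos_ge0 (EFin \o f) x).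
have := @integral_ge0 _ _ _ mu setT _ (fun x _ => funeneg_ge0 (EFin \o f) x).
move: (integral _ _ _) (integral _ _ _) => a b.
case: a => [a||] // _; case: b => [b||] // _ /=;
  rewrite ?gt0_muley ?gt0_muleNy ?lte_fin//=; by rewrite ?mulrBr ?mulr0.
Qed.

(** * Inner product, squared norm and null functions in L^2 *)

Section L2_facts.
Context {d : measure_display} {E : measurableType d} {R : realType}.
Variable mu : probability E R.
Implicit Types (f g h : E -> R) (c : R).

Lemma L2_measurable f : L2 mu f -> measurable_fun setT f.
Proof. by rewrite /L2/= inE => /andP[] /[!inE]. Qed.

Lemma L2_norm_fin_num f : L2 mu f -> 'N[mu]_2%:E[EFin \o f]%E \is a fin_num.
Proof.
rewrite /L2/= inE => /andP[_] /[!inE] Nf.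
by rewrite ge0_fin_numE ?Lnorm_ge0.
Qed.

Lemma L2Z c f : L2 mu f -> L2 mu (fun x => c * f x).
Proof.
move=> Lf; have := @Lfun_scale _ _ _ mu f c 2 _ Lf.
rewrite /L2/= (_ : c \o* f = fun x => c * f x); first by apply; rewrite ler1n.
by apply/funext => x /=; rewrite mulrC.
Qed.

Lemma L2_cst0 : L2 mu (cst 0).
Proof. exact: Lfun_cst. Qed.

Lemma L2M_integrable f g :
  L2 mu f -> L2 mu g -> mu.-integrable setT (EFin \o (fun x => f x * g x)).
Proof. by move=> Lf Lg; apply/Lfun1_integrable; exact: Lfun2_mul_Lfun1. Qed.

Lemma innerBl f g h : L2 mu f -> L2 mu g -> L2 mu h ->
  inner mu (fun x => f x - g x) h = inner mu f h - inner mu g h.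
Proof.
move=> Lf Lg Lh; rewrite /inner -RintegralB//; try exact: L2M_integrable.
by apply: eq_Rintegral => x _; rewrite mulrBl.
Qed.

Lemma innerC f g : inner mu f g = inner mu g f.
Proof. by apply: eq_Rintegral => x _; rewrite mulrC. Qed.

Lemma innerZr c f g : 0 < c -> measurable_fun setT f -> measurable_fun setT g ->
  inner mu f (fun x => c * g x) = c * inner mu f g.
Proof.
move=> c0 mf mg; rewrite /inner -gt0_RintegralZl//; last exact: measurable_funM.
by apply: eq_Rintegral => x _; rewrite mulrCA.
Qed.

Lemma inner_ae0r f g : measurable_fun setT f -> measurable_fun setT g ->
  g = cst 0 %[ae mu] -> inner mu f g = 0.
Proof.
move=> mf mg g0; rewrite /inner /Rintegral.
rewrite (ae_eq_integral (cst 0%E))//.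
- by rewrite integral0.
- by apply/measurable_EFinP; exact: measurable_funM.
- by apply: filterS g0 => x /= /[apply] ->; rewrite mulr0.
Qed.

Lemma meanZ c f : 0 < c -> L2 mu f -> mean mu (fun x => c * f x) = c * mean mu f.
Proof. by move=> c0 /L2_measurable mf; exact: gt0_RintegralZl. Qed.

Lemma L20Z c f : 0 < c -> L20 mu f -> L20 mu (fun x => c * f x).
Proof.
move=> c0 [Lf mf]; split; first exact: L2Z.
by rewrite meanZ// mf mulr0.
Qed.

Lemma sqnorm_ge0 f : 0 <= sqnorm mu f.
Proof. exact: sqr_ge0. Qed.

Lemma sqnormZ c f : L2 mu f -> sqnorm mu (fun x => c * f x) = c ^+ 2 * sqnorm mu f.
Proof.
move=> Lf; rewrite /sqnorm.
have p1 : (1 <= 2%:E :> \bar R)%E by rewrite lee_fin ler1n.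
have NZ : ('N[mu]_2%:E[EFin \o (fun x => (c * f x)%R)] =
    `|c|%:E * 'N[mu]_2%:E[EFin \o f])%E := LnormZ (Lfun_Sub p1 Lf) c.
rewrite NZ fineM//.
  by rewrite /= exprMn real_normK ?num_real.
exact: L2_norm_fin_num.
Qed.

Lemma sqnorm_eq0 f : L2 mu f -> sqnorm mu f = 0 -> f = cst 0 %[ae mu].
Proof.
move=> Lf /eqP; rewrite sqrf_eq0 => /eqP n0.
have mf := L2_measurable Lf.
have : ('N[mu]_2%:E[EFin \o f] = 0)%E.
  rewrite -[LHS]fineK ?n0//; exact: L2_norm_fin_num.
have mf' : measurable_fun setT (EFin \o f) by exact/measurable_EFinP.
have p0 : (0 < 2%:E :> \bar R)%E by rewrite lte_fin.
move=> /(Lnorm_eq0_eq0 mf' p0).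
by apply: filterS => x /= /[apply] -[].
Qed.

End L2_facts.

(** * The Dirichlet form of [PstarP]: homogeneity and null functions *)

Section kernel_dirichlet.
Context {d : measure_display} {E : measurableType d} {R : realType}.
Variables (mu : probability E R) (P : R.-pker E ~> E).
Implicit Types (f g h : E -> R) (c : R).

(** The integrals of the positive and negative parts of [f] against the kernel are measurable in
    [x], so their difference is, and so is its finite part. *)
Lemma measurable_kernel_op f :
  measurable_fun setT f -> measurable_fun setT (kernel_op P f).
Proof.
move=> /measurable_EFinP mf; apply: (measurableT_comp (fine_measurable measurableT)).
rewrite (_ : (fun x => _) =
    (fun x => \int[P x]_y (EFin \o f)^\+ y - \int[P x]_y (EFin \o f)^\- y)%E).
  apply: emeasurable_funB; apply: measurable_fun_integral_kernel => //;
    [exact: measurable_kernel|exact: measurable_funepos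
    |exact: measurable_kernel|exact: measurable_funeneg].
by apply/funext => x; rewrite -integralE.
Qed.

Lemma kernel_opZ c f : 0 < c -> measurable_fun setT f ->
  kernel_op P (fun x => c * f x) = (fun x => c * kernel_op P f x).
Proof. by move=> c0 mf; apply/funext => x; exact: gt0_RintegralZl. Qed.

(* If [has_adjoint] fails then [get] returns the default [cst 0] of [E -> R] and
   [dirichlet] is [inner f f].  Homogeneity holds in that case too, which spares
   the Riesz representation theorem. *)
Let has_adjoint g := exists h,
  L2 mu h /\ forall f, L2 mu f -> inner mu (kernel_op P f) g = inner mu f h.

Let has_adjointZ c g : 0 < c -> measurable_fun setT g ->
  has_adjoint g -> has_adjoint (fun x => c * g x).
Proof.
move=> c0 mg [h [Lh gh]]; exists (fun x => c * h x); split; first exact: L2Z.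
move=> f Lf; have mf := L2_measurable Lf.
rewrite !innerZr ?gh//; first exact: L2_measurable Lh.
exact: measurable_kernel_op.
Qed.

Let PstarP_noadjoint f : ~ has_adjoint (kernel_op P f) -> PstarP mu P f = cst 0.
Proof. by move=> nh; rewrite /PstarP /adjoint getPN// => h hh; apply: nh; exists h. Qed.

Let dirichlet_adjoint f : L2 mu f -> has_adjoint (kernel_op P f) ->
  dirichlet mu (PstarP mu P) f =
  inner mu f f - inner mu (kernel_op P f) (kernel_op P f).
Proof.
(* The defining identity of the adjoint, tested on [f] itself, turns the pairing of [f] with
   [PstarP mu P f] into the inner product of [kernel_op P f] with itself. *)
move=> Lf /getPex[Lh hh]; rewrite /dirichlet innerBl//.
by rewrite [X in _ - X]innerC -hh.
Qed.

Let dirichlet_noadjoint f : ~ has_adjoint (kernel_op P f) ->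
  dirichlet mu (PstarP mu P) f = inner mu f f.
Proof.
move=> /PstarP_noadjoint PP0; rewrite /dirichlet PP0.
by congr inner; apply/funext => x; rewrite subr0.
Qed.

Lemma L2_PstarP f : L2 mu (PstarP mu P f).
Proof.
have [/getPex[]//|/PstarP_noadjoint ->] := pselect (has_adjoint (kernel_op P f)).
exact: L2_cst0.
Qed.

Lemma dirichlet_PstarPZ c f : 0 < c -> L2 mu f ->
  dirichlet mu (PstarP mu P) (fun x => c * f x) =
  c ^+ 2 * dirichlet mu (PstarP mu P) f.
Proof.
move=> c0 Lf; have mf := L2_measurable Lf.
have mPf := measurable_kernel_op mf.
have innerZ g : measurable_fun setT g ->
    inner mu (fun x => c * g x) (fun x => c * g x) = c ^+ 2 * inner mu g g.
  move=> mg; rewrite innerZr//; last exact: measurable_funM.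
  by rewrite innerC innerZr// mulrA.
have [adjPf|nadjPf] := pselect (has_adjoint (kernel_op P f)).
  rewrite !dirichlet_adjoint ?kernel_opZ//; last 2 first.
  - exact: L2Z.
  - exact: has_adjointZ.
  by rewrite !innerZ// mulrBr.
rewrite (dirichlet_noadjoint nadjPf) -innerZ//; apply: dirichlet_noadjoint.
(* Scaling back by [c^-1] shows that [f] and [c * f] fall into the same case of the definition by
   [get]. *)
rewrite kernel_opZ// => adjPcf; apply: nadjPf.
have c'0 : 0 < c^-1 by rewrite invr_gt0.
have := has_adjointZ c'0 (measurable_funM (measurable_cst c) mPf) adjPcf.
by under eq_fun do rewrite mulKf ?gt_eqF//.
Qed.

(** Serves functions with [Phi f = 0], which cannot be scaled to the unit sphere. *)
Lemma dirichlet_PstarP_eq0 f : L2 mu f -> sqnorm mu f = 0 ->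
  dirichlet mu (PstarP mu P) f = 0.
Proof.
move=> Lf /(sqnorm_eq0 Lf); apply: inner_ae0r; last exact: L2_measurable Lf.
by apply: measurable_funB; [exact: L2_measurable Lf|exact: L2_measurable (L2_PstarP f)].
Qed.

End kernel_dirichlet.

(** * Optimal functions in the abstract: [S] stands for the unit sphere, [n] for the squared norm,
    [e] for the Dirichlet form *)

Section optimal_functions.
Context {R : realType} {X : Type}.
Variables (S : set X) (n e : X -> R).
Hypothesis e_gt0 : forall g, S g -> 0 < e g.

Let alpha (r : R) : \bar R :=
  maxe (ereal_sup [set ((n g - r)%:E / (e g)%:E)%E | g in S]) 0%E.

Let beta (s : R) : \bar R :=
  maxe (ereal_sup [set (n g - s * e g)%:E | g in S]) 0%E.

(** Multiplying by [e g > 0] clears each quotient; [0 <= s] takes care of the maximum with 0.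
    Together with [beta_leP] this is a Galois connection between [alpha] and [beta]. *)
Lemma alpha_leP (r s : R) : 0 <= s ->
  (alpha r <= s%:E)%E <-> forall g, S g -> n g <= s * e g + r.
Proof.
move=> s0; rewrite /alpha ge_max lee_fin s0 andbT.
have quotE g : S g -> ((n g - r)%:E / (e g)%:E <= s%:E)%E = (n g <= s * e g + r).
  by move=> /e_gt0 eg; rewrite inver gt_eqF// -EFinM lee_fin ler_pdivrMr// lerBlDr.
split=> [le_s g Sg|le_s].
  by rewrite -quotE//; apply: le_trans le_s; apply: ereal_sup_ubound; exists g.
by apply: ge_ereal_sup => _ [g Sg <-]; rewrite quotE// le_s.
Qed.

Lemma beta_leP (r s : R) : 0 <= r ->
  (beta s <= r%:E)%E <-> forall g, S g -> n g <= s * e g + r.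
Proof.
move=> r0; rewrite /beta ge_max lee_fin r0 andbT.
split=> [le_r g Sg|le_r].
  rewrite -lerBlDl -lee_fin; apply: le_trans le_r; apply: ereal_sup_ubound.
  by exists g.
by apply: ge_ereal_sup => _ [g Sg <-]; rewrite lee_fin lerBlDl le_r.
Qed.

Lemma alpha_ge0 r : (0 <= alpha r)%E.
Proof. by rewrite le_max lexx orbT. Qed.

Lemma beta_ge0 s : (0 <= beta s)%E.
Proof. by rewrite le_max lexx orbT. Qed.

Lemma le_alpha r t : r <= t -> (alpha t <= alpha r)%E.
Proof.
move=> rt; have := alpha_ge0 r; case E : (alpha r) => [s||] //; rewrite ?leey//.
rewrite lee_fin => s0; apply/alpha_leP => // g Sg.
have /alpha_leP : (alpha r <= s%:E)%E by rewrite E.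
by move=> /(_ s0 g Sg) /le_trans; apply; rewrite lerD2l.
Qed.

(** By monotonicity the right limit at [x] is the supremum [M] over an interval to the right of [x],
    and [M <= alpha x]. Conversely, [n g <= M * e g + x + d] for all small [d > 0], and letting [d]
    tend to 0 gives [alpha x <= M]. *)
Lemma alpha_right_continuous : pos_right_continuous alpha.
Proof.
move=> x _; have xb : (BRight x < BLeft (x + 1))%O by rewrite bnd_simp ltrDl.
have := @nonincreasing_at_right_cvge _ alpha _ _ xb.
move=> /(_ (fun u v _ _ uv => le_alpha uv)).
set M := ereal_sup _; suff -> : M = alpha x by [].
apply/eqP; rewrite eq_le; apply/andP; split.
  apply: ge_ereal_sup => z [y /=]; rewrite in_itv/= => /andP[xy _] <-.
  exact/le_alpha/ltW.
have le_M y : x < y < x + 1 -> (alpha y <= M)%E.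
  by move=> xy; apply: ereal_sup_ubound; exists y => //=; rewrite in_itv.
have M0 : (0 <= M)%E.
  by apply: le_trans (le_M (x + 2^-1) _); [exact: alpha_ge0|lra].
move: M0 le_M; case: M => [m||] //; rewrite ?leey//.
rewrite lee_fin => m0 le_m; apply/alpha_leP => // g Sg.
apply/ler_addgt0Pr => d d0.
(* The cap [2^-1] keeps [x + d'] inside the interval []x, x + 1[] that defines [M]. *)
have d'0 : 0 < Num.min d 2^-1 by rewrite lt_min d0/= invr_gt0.
have d'd : Num.min d 2^-1 <= d by rewrite ge_min lexx.
have d'2 : Num.min d 2^-1 <= 2^-1 by rewrite ge_min lexx orbT.
move: (Num.min _ _) d'0 d'd d'2 => d' d'0 d'd d'2.
have /alpha_leP : (alpha (x + d') <= m%:E)%E by apply: le_m; lra.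
by move=> /(_ m0 g Sg); lra.
Qed.

Hypothesis beta_fin : forall s, 0 < s -> (beta s < +oo)%E.

Lemma beta_geninv_alpha s : 0 < s -> beta s = geninv alpha s.
Proof.
move=> s0; have b_fin := beta_fin s0; have b_ge0 := beta_ge0 s.
rewrite -(@fineK _ (beta s)) ?ge0_fin_numE//.
set b := fine (beta s).
have b0 : 0 <= b by exact: fine_ge0.
have bE : beta s = b%:E by rewrite fineK ?ge0_fin_numE.
apply/eqP; rewrite eq_le; apply/andP; split.
  apply: le_ereal_inf_tmp => _ [y [y0 ay] <-]; rewrite -bE.
  by apply/beta_leP; [exact: ltW|apply/alpha_leP => //; exact: ltW].
(* [geninv] ranges over positive arguments only and [b] may be 0, hence [b + d] in place of [b]. *)
apply/lee_addgt0Pr => d d0; apply: ereal_inf_lbound.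
exists (b + d) => //; split; first exact: ltr_wpDl.
apply/alpha_leP; first exact: ltW.
apply/beta_leP; first by rewrite addr_ge0// ltW.
by rewrite bE lee_fin lerDl ltW.
Qed.

End optimal_functions.

(** * The sieve, its unit sphere and normalization *)

Section unit_sphere.
Context {d : measure_display} {E : measurableType d} {R : realType}.
Variables (mu : probability E R) (Phi : (E -> R) -> \bar R).
Hypothesis sievePhi : sieve mu Phi.
Implicit Types (f g : E -> R).

Definition unit_sphere : set (E -> R) := [set g | L20 mu g /\ Phi g = 1%E].

Lemma L20_sqnorm_le f : L20 mu f -> ((sqnorm mu f)%:E <= sieve_cst mu Phi * Phi f)%E.
Proof.
move=> [Lf mf]; have := sieve_le sievePhi Lf; rewrite mf.
by under eq_fun do rewrite subr0.
Qed.

Lemma Phi_eq0 f : L20 mu f -> Phi f = 0%E -> sqnorm mu f = 0.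
Proof.
move=> Lf Phi0; apply/eqP; rewrite eq_le sqnorm_ge0 andbT -lee_fin.
by have := L20_sqnorm_le Lf; rewrite Phi0 mule0.
Qed.

(** A null [g] would give [Phi (cst 0) = 1], whereas homogeneity with factor 2 gives
    [Phi (cst 0) = 4 * Phi (cst 0)]. *)
Lemma sqnorm_unit_gt0 g : unit_sphere g -> 0 < sqnorm mu g.
Proof.
move=> [[Lg _] Phi1]; rewrite lt_def sqnorm_ge0 andbT.
apply/eqP => /(sqnorm_eq0 Lg) g0.
have Phi01 : Phi (cst 0) = 1%E.
  by rewrite -Phi1; apply: esym; apply: (sieve_ae sievePhi) => //; exact: L2_cst0.
have := sieve_homog sievePhi (ltr0Sn R 1) (L2_cst0 mu).
under eq_fun do rewrite mulr0.
rewrite [LHS]Phi01 Phi01 mule1 => -[]; lra.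
Qed.

Lemma sqnorm_unit_le g : unit_sphere g -> ((sqnorm mu g)%:E <= sieve_cst mu Phi)%E.
Proof. by move=> [Lg Phi1]; have := L20_sqnorm_le Lg; rewrite Phi1 mule1. Qed.

Lemma unit_normalize f (c : R) : L20 mu f -> 0 < c -> Phi f = c%:E ->
  unit_sphere (fun x => (Num.sqrt c)^-1 * f x).
Proof.
move=> Lf c0 Phic.
have sc0 : 0 < (Num.sqrt c)^-1 by rewrite invr_gt0 sqrtr_gt0.
split; first exact: L20Z.
rewrite (sieve_homog sievePhi)//; last by case: Lf.
by rewrite Phic exprVn sqr_sqrtr ?ltW// -EFinM mulVf// gt_eqF.
Qed.

Lemma sqnorm_normalize f (c : R) : L2 mu f -> 0 < c ->
  sqnorm mu (fun x => (Num.sqrt c)^-1 * f x) = c^-1 * sqnorm mu f.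
Proof. by move=> Lf c0; rewrite sqnormZ// exprVn sqr_sqrtr// ltW. Qed.

(** Some [f] has a quotient above [v]. Its [Phi f] is not [+oo], where the quotient is 0, nor 0,
    where [f] would be null; so [f] can be normalized. *)
Lemma lt_sieve_cst (v : R) : 0 <= v -> (v%:E < sieve_cst mu Phi)%E ->
  exists2 g, unit_sphere g & v < sqnorm mu g.
Proof.
move=> v0 /ereal_sup_gt[_ [f [Lf f0] <-]].
case PhiE : (Phi f) => [c||]; last 2 first.
- by rewrite invey mule0 ltNge lee_fin v0.
- by have := sieve_ge0 sievePhi Lf.1; rewrite PhiE.
have [c0|c0] := eqVneq c 0.
  exfalso; apply: f0; apply: (sqnorm_eq0 Lf.1).
  by apply: Phi_eq0 => //; rewrite PhiE c0.
have {}c0 : 0 < c by rewrite lt_def c0 -lee_fin -PhiE (sieve_ge0 sievePhi)//; case: Lf.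
rewrite inver gt_eqF// -EFinM lte_fin => vf.
exists (fun x => (Num.sqrt c)^-1 * f x); first exact: unit_normalize.
by rewrite sqnorm_normalize//; [rewrite mulrC|case: Lf].
Qed.

End unit_sphere.

(** * The optimal functions satisfy a WPI *)

Section optimal_WPI.
Context {d : measure_display} {E : measurableType d} {R : realType}.
Variables (mu : probability E R) (Phi : (E -> R) -> \bar R).
Hypothesis sievePhi : sieve mu Phi.
Variables (P : R.-pker E ~> E) (alpha beta : R -> \bar R).
Hypothesis wpi : WPI mu Phi (PstarP mu P) alpha beta.
Let T := PstarP mu P.

Let WPI_absorb0 (r : R) : 0 < r -> exists2 s : R, 0 <= s &
  forall g, unit_sphere mu Phi g -> sqnorm mu g <= s * dirichlet mu T g + r.
Proof.
(* With [Phi g = 1], the first form of WPI allows [s = alpha r], possibly 0; the second allows any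
   [s > 0] with [beta s <= r], which exists because [beta] tends to 0. *)
move=> r0; case: wpi => [[[afin _ aP] _ _ _]|[[bfin _ b0 bP] _ _ _]].
- have := afin _ r0; case ar : (alpha r) => [s||]; rewrite ?ltxx ?andbF//.
  rewrite lee_fin => /andP[s0 _]; exists s => // g [Lg Phi1].
  by have := aP r g r0 Lg; rewrite Phi1 ar mule1 -EFinM -EFinD lee_fin.
- have [s [s0 bs]] : exists s : R, 0 < s /\ (beta s <= r%:E)%E.
    have beta_lt : \forall s \near +oo%R, (beta s < r%:E)%E.
      apply: (b0 [set y | (y < r%:E)%E]); exact: open_ereal_lt'.
    have [s [s0 /ltW bs]] := filter_ex (filterI (nbhs_pinfty_gt (num_real 0)) beta_lt).
    by exists s.
  exists s; first exact: ltW.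
  move=> g [Lg Phi1]; rewrite -lee_fin EFinD.
  apply: (le_trans (bP s g s0 Lg _)); first by rewrite Phi1 ltry.
  by rewrite Phi1 mule1 leeD2l.
Qed.

(** With [r] equal to half of [sqnorm mu g], the other half is bounded by [s * dirichlet mu T g],
    which is therefore positive. *)
Lemma dirichlet_unit_gt0 g : unit_sphere mu Phi g -> 0 < dirichlet mu T g.
Proof.
move=> Sg; have n0 := sqnorm_unit_gt0 sievePhi Sg.
have n20 : 0 < sqnorm mu g / 2 by rewrite divr_gt0.
have [s s0 /(_ g Sg) nle] := WPI_absorb0 n20.
rewrite ltNge; apply/negP => e0.
have : s * dirichlet mu T g <= 0 by rewrite mulr_ge0_le0.
lra.
Qed.

Lemma WPI_absorb (r : R) : 0 < r -> exists2 s : R, 0 < s &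
  forall g, unit_sphere mu Phi g -> sqnorm mu g <= s * dirichlet mu T g + r.
Proof.
move=> r0; have [s s0 sP] := WPI_absorb0 r0; exists (s + 1); first exact: ltr_wpDl.
move=> g Sg; apply: (le_trans (sP g Sg)).
by rewrite lerD2r ler_wpM2r// ?lerDl// ltW// dirichlet_unit_gt0.
Qed.

Lemma beta_star_lty s : 0 < s -> (beta_star mu Phi T s < +oo)%E.
Proof.
move=> s0; rewrite /beta_star gt_max ltry andbT.
apply: le_lt_trans (sieve_cst_fin sievePhi).
apply: ge_ereal_sup => _ [g Sg <-]; apply: le_trans (sqnorm_unit_le sievePhi Sg).
by rewrite lee_fin lerBlDr lerDl mulr_ge0// ltW// dirichlet_unit_gt0.
Qed.

Let alpha_starP (r s : R) : 0 <= s -> (alpha_star mu Phi T r <= s%:E)%E <->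
  forall g, unit_sphere mu Phi g -> sqnorm mu g <= s * dirichlet mu T g + r.
Proof. exact: (alpha_leP (sqnorm mu) dirichlet_unit_gt0). Qed.

Lemma alpha_star_fin r : 0 < r -> (0 <= alpha_star mu Phi T r < +oo)%E.
Proof.
move=> r0; rewrite alpha_ge0/=; have [s s0 sP] := WPI_absorb r0.
apply: (@le_lt_trans _ _ s%:E); last exact: ltry.
by apply/alpha_starP => //; exact: ltW.
Qed.

Lemma WPI_alpha_star : WPI_alpha mu Phi T (alpha_star mu Phi T).
Proof.
split; first exact: alpha_star_fin.
  by move=> r t _; exact: (le_alpha (sqnorm mu) dirichlet_unit_gt0).
move=> r f r0 Lf; have := alpha_star_fin r0.
case aE : (alpha_star mu Phi T r) => [s||]; rewrite ?ltxx ?andbF// => /andP[s0 _].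
(* If [Phi f = +oo], the right side is [+oo] since [r > 0]. *)
have := sieve_ge0 sievePhi Lf.1; case PhiE : (Phi f) => [c||]//; last first.
  by rewrite gt0_muley ?lte_fin// -EFinM addey ?leey.
(* If [Phi f = 0], the sieve inequality makes [f] null and both sides vanish. *)
rewrite lee_fin le_eqVlt => /predU1P[c0|c0].
  have f0 := Phi_eq0 sievePhi Lf.
  rewrite dirichlet_PstarP_eq0 ?f0 ?mule0 ?adde0 ?PhiE -?c0//; last by case: Lf.
  by rewrite mule0 adde0.
(* Otherwise the bound for the normalized function, multiplied by [c], is the bound for [f]. *)
have Sg := unit_normalize sievePhi Lf c0 PhiE.
have /alpha_starP : (alpha_star mu Phi T r <= s%:E)%E by rewrite aE.
move=> /(_ s0 _ Sg); rewrite /T dirichlet_PstarPZ ?invr_gt0 ?sqrtr_gt0//;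
  last by case: Lf.
rewrite sqnorm_normalize//; last by case: Lf.
rewrite exprVn sqr_sqrtr; last exact: ltW.
rewrite -!EFinM -EFinD lee_fin (mulrCA s) ler_pdivrMl// mulrDr mulVKf ?gt_eqF//.
by rewrite (mulrC c).
Qed.

Lemma WPI_star : WPI mu Phi T (alpha_star mu Phi T) (beta_star mu Phi T).
Proof.
left; split.
- exact: WPI_alpha_star.
- exact: (@alpha_right_continuous _ _ _ (sqnorm mu) _ dirichlet_unit_gt0).
(* Above the sieve constant, [s = 0] already works. *)
- move=> r r0 ar; apply/eqP; rewrite eq_le alpha_ge0 andbT.
  apply/alpha_starP => // g Sg.
  by rewrite mul0r add0r -lee_fin (le_trans _ ar)// sqnorm_unit_le.
- exact: (beta_geninv_alpha dirichlet_unit_gt0 beta_star_lty).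
Qed.

End optimal_WPI.

(** * Values of partial inverses; measurability of monotone functions *)

Lemma pinvP {T U : Type} (dflt : U -> T) (A : set T) (f : T -> U) (y : U) :
  (f @` A) y /\ A ('pinv_dflt A f y) /\ f ('pinv_dflt A f y) = y \/
  ~ (f @` A) y /\ 'pinv_dflt A f y = dflt y.
Proof.
rewrite /pinv_ splitV /= oinv_surj; case: pselect => [fy|nfy] /=; [left|by right].
by case: cid2 => x /= Ax fx.
Qed.

(** Preimages of upper rays are intervals. *)
Lemma nonincreasing_emeasurable {R : realType} (f : R -> \bar R) :
  (forall x y, x <= y -> (f y <= f x)%E) -> measurable_fun setT f.
Proof.
move=> f_ni; apply: (measurability _ (ErealGenOInfty.measurableE R)).
move=> /= _ [_ [r ->] <-]; apply: measurableI => //.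
apply: is_interval_measurable => x y /=; rewrite !in_itv/= !andbT.
move=> _ ry z /andP[_ zy]; rewrite in_itv/= andbT.
exact: lt_le_trans (f_ni _ _ zy).
Qed.

(** * Bounds on [Kstar] and on its integral [Ffun] *)

Section Kstar_facts.
Context {R : realType}.
Implicit Types (beta : R -> \bar R) (a u v s x y : R).

Lemma Kstar_ge0 beta v : (0 <= Kstar beta v)%E.
Proof.
by apply: ereal_sup_ubound; exists 0; rewrite /= ?lexx// /Kfun eqxx mul0r sube0.
Qed.

Lemma le_Kstar beta x y : x <= y -> (Kstar beta x <= Kstar beta y)%E.
Proof.
move=> xy; apply: ge_ereal_sup => _ [u u0 <-]; apply: le_trans; last first.
  by apply: ereal_sup_ubound; exists u.
by rewrite leeD2r// lee_fin ler_wpM2l.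
Qed.

Lemma le_Kstar_fun (beta1 beta2 : R -> \bar R) v :
  (forall s, 0 < s -> (beta1 s <= beta2 s)%E) -> (Kstar beta2 v <= Kstar beta1 v)%E.
Proof.
move=> le_b; apply: ge_ereal_sup => _ [u u0 <-]; apply: le_trans; last first.
  by apply: ereal_sup_ubound; exists u.
rewrite leeB// /Kfun; case: eqP => // /eqP u_neq0.
by rewrite lee_wpmul2l ?lee_fin// le_b// invr_gt0 lt_def u_neq0.
Qed.

(** This is the term [u = s^-1] of the supremum. *)
Lemma Kstar_ge beta s v (b : R) : 0 < s -> (beta s <= b%:E)%E ->
  (((v - b) / s)%:E <= Kstar beta v)%E.
Proof.
move=> s0 sb; apply: le_ereal_sup_tmp.
exists ((s^-1 * v)%:E - Kfun beta s^-1)%E.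
  by exists s^-1 => //=; rewrite invr_ge0 ltW.
rewrite mulrC mulrBr EFinB leeB// /Kfun gt_eqF ?invr_gt0// invrK EFinM.
by rewrite lee_wpmul2l// lee_fin invr_ge0 ltW.
Qed.

(** For [u > 0], the affine lower bound at [s = u^-1] gives [Kfun beta u >= u * x - e], so each term
    is at most [e - u * (x - v) <= e]. *)
Lemma Kstar_le beta v x (e : R) : 0 <= e -> v <= x ->
  (forall s, 0 < s -> ((x - s * e)%:E <= beta s)%E) -> (Kstar beta v <= e%:E)%E.
Proof.
move=> e0 vx le_b; apply: ge_ereal_sup => _ [u /= u0 <-].
rewrite /Kfun; case: eqP => [->|/eqP u_neq0].
  by rewrite mul0r sube0 lee_fin.
have {u_neq0}u0 : 0 < u by rewrite lt_def u_neq0.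
have iu0 : 0 < u^-1 by rewrite invr_gt0.
have uv : u * v <= u * x by rewrite ler_pM2l.
apply: (@le_trans _ _ ((u * v)%:E - (u%:E * (x - u^-1 * e)%:E)))%E.
  by rewrite leeB// lee_wpmul2l ?le_b// lee_fin ltW.
by rewrite -EFinM -EFinB lee_fin mulrBr mulVKf ?gt_eqF//; lra.
Qed.

Lemma Kstar_inv_ge0 beta v : (0 <= (Kstar beta v)^-1)%E.
Proof. by rewrite inve_ge0 Kstar_ge0. Qed.

Lemma Kstar_inv_nonincreasing beta x y :
  x <= y -> ((Kstar beta y)^-1 <= (Kstar beta x)^-1)%E.
Proof. by move=> xy; rewrite lee_pV2 ?inE ?Kstar_ge0// le_Kstar. Qed.

Lemma measurable_Kstar_inv beta D : measurable_fun D (fun v => (Kstar beta v)^-1%E).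
Proof.
apply: measurable_funTS; apply: nonincreasing_emeasurable => x y.
exact: Kstar_inv_nonincreasing.
Qed.

Lemma Ffun_split a beta x y : x <= y <= a -> Ffun a beta x =
  (\int[lebesgue_measure]_(v in `[x, y[) (Kstar beta v)^-1 + Ffun a beta y)%E.
Proof.
move=> /andP[xy ya]; rewrite /Ffun (itv_bndbnd_setU (x := BLeft y)) ?bnd_simp//.
rewrite ge0_integral_setU//.
- exact: measurable_Kstar_inv.
- by move=> v _; exact: Kstar_inv_ge0.
- by apply: lt_disjoint => u v; rewrite !in_itv/= => /andP[_ uy] /andP[/(lt_le_trans uy)].
Qed.

Lemma Ffun_ge0 a beta x : (0 <= Ffun a beta x)%E.
Proof. by apply: integral_ge0 => v _; exact: Kstar_inv_ge0. Qed.

Lemma Ffun_end a beta : Ffun a beta a = 0%E.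
Proof. by rewrite /Ffun set_itv1 integral_set1. Qed.

Lemma integral_co_cst x y (c : R) : x <= y ->
  (\int[lebesgue_measure]_(v in `[x, y[) cst c%:E v = (c * (y - x))%:E)%E.
Proof.
rewrite le_eqVlt => /predU1P[->|xy].
  by rewrite set_itvco0 integral_set0 subrr mulr0.
by rewrite integral_cst//= lebesgue_measure_itv/= lte_fin xy -EFinB -EFinM.
Qed.

(** The integrand is nonincreasing, so its value at [x] bounds it on [[x, y[]. *)
Lemma Ffun_lipschitz a beta x y (M : R) : ((Kstar beta x)^-1 <= M%:E)%E ->
  x <= y <= a -> (Ffun a beta x <= (M * (y - x))%:E + Ffun a beta y)%E.
Proof.
move=> KM xya; rewrite (Ffun_split beta xya) leeD2r//.
have /andP[xy _] := xya; rewrite -integral_co_cst//.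
apply: ge0_le_integral => //=.
- by move=> v _; exact: Kstar_inv_ge0.
- exact: measurable_Kstar_inv.
- move=> v; rewrite in_itv/= => /andP[xv _]; apply: le_trans KM.
  exact: Kstar_inv_nonincreasing.
Qed.

Lemma Ffun_strict a beta x y (e : R) : 0 < e -> (Kstar beta y <= e%:E)%E ->
  x <= y <= a -> ((e^-1 * (y - x))%:E + Ffun a beta y <= Ffun a beta x)%E.
Proof.
move=> e0 Ke xya; rewrite (Ffun_split beta xya) leeD2r//.
have /andP[xy _] := xya; rewrite -integral_co_cst//.
apply: ge0_le_integral => //=.
- by move=> v _; rewrite lee_fin invr_ge0 ltW.
- exact: measurable_Kstar_inv.
- move=> v; rewrite in_itv/= => /andP[_ /ltW vy].
  have -> : (e^-1)%:E = (e%:E)^-1%E by rewrite inver gt_eqF.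
  have e_ge0 : (0 <= e%:E)%E by rewrite lee_fin ltW.
  rewrite lee_pV2 ?inE ?Kstar_ge0//.
  exact: le_trans (le_Kstar _ vy) Ke.
Qed.

Lemma Ffun_nonincreasing a beta x y : x <= y <= a -> (Ffun a beta y <= Ffun a beta x)%E.
Proof.
move=> xya; rewrite (Ffun_split beta xya) leeDr// integral_ge0// => v _.
exact: Kstar_inv_ge0.
Qed.

Lemma le_Ffun a (beta1 beta2 : R -> \bar R) x :
  (forall s, 0 < s -> (beta1 s <= beta2 s)%E) -> (Ffun a beta1 x <= Ffun a beta2 x)%E.
Proof.
move=> le_b; apply: ge0_le_integral => //=.
- by move=> v _; exact: Kstar_inv_ge0.
- exact: measurable_Kstar_inv.
- exact: measurable_Kstar_inv.
- by move=> v _; rewrite lee_pV2 ?inE ?Kstar_ge0// le_Kstar_fun.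
Qed.

End Kstar_facts.

(** * Comparison of convergence rates *)

Section rate_comparison.
Context {R : realType}.
Implicit Types (beta : R -> \bar R) (a x y : R).

(** On [[x, a]] the function [Ffun a beta] is finite and Lipschitz and vanishes at [a], so the
    intermediate value theorem applies. *)
Lemma Ffun_IVT a beta x y : 0 < x <= a ->
  (forall r, 0 < r -> exists2 s, 0 < s & (beta s <= r%:E)%E) ->
  0 <= y -> (y%:E <= Ffun a beta x)%E ->
  exists2 z, x <= z <= a & Ffun a beta z = y%:E.
Proof.
move=> /andP[x0 xa] b_small y0 yF.
have x20 : 0 < x / 2 by rewrite divr_gt0.
(* Since [beta s <= x / 2], [Kstar_ge] bounds [Kstar beta x] below by [(x - x / 2) / s]; its inverse
   [M] is the Lipschitz constant. *)
have [s s0 bs] := b_small _ x20.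
pose M := ((x - x / 2) / s)^-1.
have Mi0 : 0 < (x - x / 2) / s by rewrite divr_gt0//; lra.
have M0 : 0 <= M by rewrite invr_ge0 ltW.
have KM z : x <= z -> ((Kstar beta z)^-1 <= M%:E)%E.
  move=> xz; apply: le_trans (Kstar_inv_nonincreasing beta xz) _.
  have -> : M%:E = (((x - x / 2) / s)%:E)^-1%E by rewrite inver gt_eqF.
  have Mi_ge0 : (0 <= ((x - x / 2) / s)%:E)%E by rewrite lee_fin ltW.
  rewrite lee_pV2 ?inE ?Kstar_ge0//.
  exact: Kstar_ge.
have Ffin z : x <= z <= a -> Ffun a beta z \is a fin_num.
  move=> /andP[xz za]; rewrite ge0_fin_numE ?Ffun_ge0//.
  have zaa : z <= a <= a by rewrite za lexx.
  by apply: le_lt_trans (Ffun_lipschitz (KM z xz) zaa) _; rewrite Ffun_end adde0 ltry.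
pose f z := fine (Ffun a beta z).
have fE z : x <= z <= a -> Ffun a beta z = (f z)%:E by move=> /Ffin /fineK.
have f_lip z w : x <= z -> z <= w -> w <= a -> `|f z - f w| <= M * `|z - w|.
  move=> xz zw wa.
  have zwa : z <= w <= a by rewrite zw.
  have := Ffun_lipschitz (KM z xz) zwa; have := Ffun_nonincreasing beta zwa.
  rewrite !fE ?xz ?wa ?(le_trans xz zw) ?(le_trans zw wa)//.
  rewrite -EFinD !lee_fin => fzw fwz.
  by rewrite ger0_norm ?subr_ge0// distrC ger0_norm ?subr_ge0// lerBlDr.
have f_cont : {within `[x, a], continuous f}.
  apply/subspace_continuousP => z; rewrite /= in_itv/= => /andP[xz za].
  apply/cvgrPdist_le => d d0.
  have M1 : 0 < M + 1 by rewrite ltr_wpDl.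
  have dM : 0 < d / (M + 1) by rewrite divr_gt0.
  apply/nbhs_ballP; exists (d / (M + 1)) => //= w.
  rewrite /ball/= in_itv/= => zw /andP[xw wa].
  have f_zw : `|f z - f w| <= M * `|z - w|.
    have [zlew|/ltW wlez] := leP z w; first exact: f_lip.
    by rewrite distrC (distrC z); exact: f_lip.
  apply: (le_trans f_zw); apply: (@le_trans _ _ ((M + 1) * (d / (M + 1)))).
    by apply: ler_pM => //; [rewrite lerDl|exact: ltW].
  by rewrite mulrC divfK ?gt_eqF.
have xx : x <= x <= a by rewrite lexx.
have aa : x <= a <= a by rewrite lexx xa.
have fa : f a = 0 by rewrite /f Ffun_end.
have fx : y <= f x by rewrite -lee_fin -fE.
have [z + fz] : exists2 z, z \in `[x, a] & f z = y.
  by apply: (IVT xa f_cont); rewrite fa ge_min le_max y0 fx orbT.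
by rewrite in_itv/= => xza; exists z => //; rewrite fE// fz.
Qed.

Lemma le_rate a (beta1 beta2 : R -> \bar R) n :
  (forall s, 0 < s -> (beta1 s <= beta2 s)%E) ->
  (forall r, 0 < r -> exists2 s, 0 < s & (beta2 s <= r%:E)%E) ->
  (forall v, 0 <= v < a -> exists2 x, v <= x & exists2 e, 0 < e &
    forall s, 0 < s -> ((x - s * e)%:E <= beta1 s)%E) ->
  rate a beta1 n <= rate a beta2 n.
Proof.
move=> le_b b2_small b1_large; rewrite /rate.
set A := [set x | 0 < x <= a].
(* If [n] is not a value of the first function, the first rate is the default 0, and the second is
   nonnegative in either case. *)
have [[_ [Ag1 F1g1]]|[_ ->]] := pinvP (fun=> 0) A (Ffun a beta1) n%:R%:E; last first.
  by have [[_ [/andP[/ltW]]]|[_ ->]] := pinvP (fun=> 0) A (Ffun a beta2) n%:R%:E.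
move: ('pinv_(fun=> 0) A (Ffun a beta1) _) Ag1 F1g1 => g1 /= /andP[g1_gt0 g1a] F1g1.
(* At [g1] the second function is at least [n], so it takes the value [n] on [[g1, a]]. *)
have n_in2 : (Ffun a beta2 @` A) n%:R%:E.
  have [||z /andP[g1z za] Fz] := @Ffun_IVT a beta2 g1 n%:R _ b2_small (ler0n _ _).
  - by rewrite g1_gt0.
  - by rewrite -F1g1 le_Ffun.
  - by exists z => //; rewrite /A/= za (lt_le_trans g1_gt0).
have [[_ [Ag2 F2g2]]|[]//] := pinvP (fun=> 0) A (Ffun a beta2) n%:R%:E.
move: ('pinv_(fun=> 0) A (Ffun a beta2) _) Ag2 F2g2 => g2 /= /andP[g2_gt0 g2a] F2g2.
rewrite leNgt; apply/negP => g21.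
(* A bound on [Kstar beta1] is available only strictly below [a], while [g1] may equal [a]; hence a
   midpoint. On [[g2, w]] the first function drops strictly, so it exceeds [n] at [g2], where the
   second, larger one equals [n]. *)
pose w := (g2 + g1) / 2.
have [g2w wg1] : g2 < w /\ w < g1 by rewrite /w; split; lra.
have [|x wx [e e0 eP]] := b1_large w; first by apply/andP; split; lra.
have Ke := Kstar_le (ltW e0) wx eP.
have g2wa : g2 <= w <= a by apply/andP; split; lra.
have wg1a : w <= g1 <= a by apply/andP; split; lra.
have := Ffun_strict e0 Ke g2wa; apply/negP; rewrite -ltNge.
apply: (@le_lt_trans _ _ n%:R%:E); first by rewrite -F2g2 le_Ffun.
apply: (@lt_le_trans _ _ ((e^-1 * (w - g2))%:E + n%:R%:E)%E).
  by rewrite -EFinD lte_fin ltrDr mulr_gt0 ?invr_gt0 ?subr_gt0.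
by rewrite leeD2l// -F1g1 Ffun_nonincreasing.
Qed.

End rate_comparison.

(** * Application to [beta_star] *)

Section beta_star_facts.
Context {d : measure_display} {E : measurableType d} {R : realType}.
Variables (mu : probability E R) (Phi : (E -> R) -> \bar R).
Hypothesis sievePhi : sieve mu Phi.

Lemma le_beta_star (T1 T2 : (E -> R) -> E -> R) (s : R) : 0 < s ->
  (forall g, unit_sphere mu Phi g -> dirichlet mu T2 g <= dirichlet mu T1 g) ->
  (beta_star mu Phi T1 s <= beta_star mu Phi T2 s)%E.
Proof.
move=> s0 le_dir; rewrite /beta_star ge_max beta_ge0 andbT.
apply: ge_ereal_sup => _ [g Sg <-]; rewrite le_max; apply/orP; left.
apply: le_ereal_sup_tmp; exists (sqnorm mu g - s * dirichlet mu T2 g)%:E.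
  by exists g.
by rewrite lee_fin lerB// ler_pM2l// le_dir.
Qed.

Lemma beta_star_ge (T : (E -> R) -> E -> R) (s : R) g : unit_sphere mu Phi g ->
  ((sqnorm mu g - s * dirichlet mu T g)%:E <= beta_star mu Phi T s)%E.
Proof.
move=> Sg; rewrite le_max; apply/orP; left.
by apply: ereal_sup_ubound; exists g.
Qed.

Lemma le_rate_star (P1 P2 : R.-pker E ~> E) (alpha1 beta1 alpha2 beta2 : R -> \bar R) n :
  WPI mu Phi (PstarP mu P1) alpha1 beta1 ->
  WPI mu Phi (PstarP mu P2) alpha2 beta2 ->
  (forall g, unit_sphere mu Phi g ->
    dirichlet mu (PstarP mu P2) g <= dirichlet mu (PstarP mu P1) g) ->
  rate_star mu Phi (PstarP mu P1) n <= rate_star mu Phi (PstarP mu P2) n.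
Proof.
move=> wpi1 wpi2 le_dir; apply: le_rate.
- by move=> s s0; exact: le_beta_star.
- move=> r r0; have [s s0 sP] := WPI_absorb sievePhi wpi2 r0; exists s => //.
  exact/(beta_leP _ _ _ _ (ltW r0)).
(* [beta_star] dominates the affine function given by any [g] on the unit sphere. Choosing [g] with
   [v < sqnorm mu g] yields [x = sqnorm mu g] and the slope [e], its Dirichlet form. *)
- move=> v /andP[v0 va].
  have va' : (v%:E < sieve_cst mu Phi)%E.
    move: va (sieve_cst_fin sievePhi); case: (sieve_cst mu Phi) => [c||]//=.
    by rewrite ltNge v0.
  have [g Sg vg] := lt_sieve_cst sievePhi v0 va'.
  exists (sqnorm mu g); first exact: ltW.
  exists (dirichlet mu (PstarP mu P1) g); first exact: (dirichlet_unit_gt0 sievePhi wpi1).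
  by move=> s s0; exact: beta_star_ge.
Qed.

End beta_star_facts.

Theorem theorem31 (d : measure_display) (E : measurableType d) (R : realType)
    (mu : probability E R) (P1 P2 : R.-pker E ~> E)
    (Phi : (E -> R) -> \bar R) (alpha1 beta1 alpha2 beta2 : R -> \bar R)
    (inv1 : invariant_kernel mu P1) (inv2 : invariant_kernel mu P2)
    (sievePhi : sieve mu Phi)
    (nonexp1 : nonexpansive mu Phi P1) (nonexp2 : nonexpansive mu Phi P2)
    (Phi_nontrivial : exists f : E -> R, L20 mu f /\ (0 < Phi f < +oo)%E)
    (wpi1 : WPI mu Phi (PstarP mu P1) alpha1 beta1)
    (wpi2 : WPI mu Phi (PstarP mu P2) alpha2 beta2)
    (dirichlet_le : forall g : E -> R, L2 mu g -> (Phi g <= 1)%E ->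
       dirichlet mu (PstarP mu P2) g <= dirichlet mu (PstarP mu P1) g) :
  [/\ WPI mu Phi (PstarP mu P1) (alpha_star mu Phi (PstarP mu P1))
        (beta_star mu Phi (PstarP mu P1)),
      WPI mu Phi (PstarP mu P2) (alpha_star mu Phi (PstarP mu P2))
        (beta_star mu Phi (PstarP mu P2)) &
      forall n : nat,
        rate_star mu Phi (PstarP mu P1) n <= rate_star mu Phi (PstarP mu P2) n].
Proof.
split; [exact: (WPI_star sievePhi wpi1)|exact: (WPI_star sievePhi wpi2)|move=> n].
apply: (le_rate_star sievePhi n wpi1 wpi2) => g [[Lg _] Phi1].
by apply: dirichlet_le; rewrite ?Phi1.
Qed.
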